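(* Let $M$ be a macro scheme of size $b$ for a string $T$. Then $T$ has a string attractor of size at most $2b$.
   Context: A string attractor of a string $T$ of length $n$ is a set $\Gamma\subseteq\{1,\dots,n\}$ such that every substring $T[i..j]$ has an occurrence $T[i'..j']=T[i..j]$ with $p\in[i',j']$ for some $p\in\Gamma$. A macro scheme of size $b$ for $T$ is a set of $b$ directives, each either of the form $T[i..j]\leftarrow T[i'..j']$ (copy $T[i'..j']$ into $T[i..j]$) or $T[i]\leftarrow c$ with $c$ a character (assign $c$ to $T[i]$), such that $T$ can be unambiguously decoded from the directives: every position $p$ of $T$ is resolved by a finite chain of copies $T[p_1]\leftarrow T[p_2]\leftarrow\cdots\leftarrow T[p_{k}]\leftarrow c$ (with $p_1=p$) induced by the directives and ending in an assignment directive. *)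

(* Defs.v *)
From HB Require Import structures.
From mathcomp Require Import all_boot finmap.

Set Implicit Arguments.
Unset Strict Implicit.
Unset Printing Implicit Defensive.

(* A string of length n is an n.-tuple. Positions are 0-based: the position p
   of {1, .., n} is the element of 'I_n with value p - 1. *)

Definition substr (Sigma : Type) (n : nat) (T : n.-tuple Sigma) (i j : 'I_n) :
  seq Sigma := take (j.+1 - i) (drop i T).

Definition string_attractor (Sigma : Type) (n : nat) (T : n.-tuple Sigma)
    (G : {set 'I_n}) : Prop :=
  forall i j : 'I_n, i <= j ->
  exists i' j' p : 'I_n,
    [/\ i' <= j', substr T i' j' = substr T i j, p \in G & i' <= p <= j'].

(* Copy i j i' j' is T[i..j] <- T[i'..j'], and Assign i c is T[i] <- c. *)
Inductive directive (n : nat) (Sigma : Type) : Type :=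
| Copy of 'I_n & 'I_n & 'I_n & 'I_n
| Assign of 'I_n & Sigma.

Arguments Copy {n Sigma} _ _ _ _.
Arguments Assign {n Sigma} _ _.

Section DirectiveChoice.
Variables (n : nat) (Sigma : choiceType).

Definition directive_encode (d : directive n Sigma) :
  ('I_n * 'I_n * 'I_n * 'I_n) + ('I_n * Sigma) :=
  match d with
  | Copy i j i' j' => inl (i, j, i', j')
  | Assign i c => inr (i, c)
  end.

Definition directive_decode
    (x : ('I_n * 'I_n * 'I_n * 'I_n) + ('I_n * Sigma)) : directive n Sigma :=
  match x with
  | inl (i, j, i', j') => Copy i j i' j'
  | inr (i, c) => Assign i c
  end.

Lemma directive_encodeK : cancel directive_encode directive_decode.
Proof. by case. Qed.

HB.instance Definition _ :=
  Choice.copy (directive n Sigma) (can_type directive_encodeK).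

End DirectiveChoice.

Definition wf_directive (n : nat) (Sigma : Type) (d : directive n Sigma) : bool :=
  match d with
  | Copy i j i' j' => [&& i <= j, i' <= j' & j - i == j' - i']
  | Assign _ _ => true
  end.

(* copy_step M p q: some directive of M induces the copy T[p] <- T[q]. *)
Definition copy_step (n : nat) (Sigma : choiceType)
    (M : {fset directive n Sigma}) (p q : 'I_n) : Prop :=
  exists i j i' j' : 'I_n,
    [/\ Copy i j i' j' \in M, i <= p <= j & nat_of_ord q = i' + (p - i)].

(* resolves M p c: there is a finite chain T[p] <- T[p_2] <- ... <- T[p_k] <- c
   induced by the directives of M. *)
Inductive resolves (n : nat) (Sigma : choiceType)
    (M : {fset directive n Sigma}) : 'I_n -> Sigma -> Prop :=
| resolves_assign p c : Assign p c \in M -> resolves M p c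
| resolves_copy p q c : copy_step M p q -> resolves M q c -> resolves M p c.

(* Left-hand sides of directives may overlap, so a position can have several
   chains. Decoding is unambiguous when every position has a chain and all
   chains of p end in the same character, which must be T[p]. *)
Definition macro_scheme (n : nat) (Sigma : choiceType) (T : n.-tuple Sigma)
    (M : {fset directive n Sigma}) : Prop :=
  (forall d, d \in M -> wf_directive d) /\
  (forall (p : 'I_n) (c : Sigma), resolves M p c <-> c = tnth T p).

(* Main.v *)
Require Import Defs.
From HB Require Import structures.
From mathcomp Require Import all_boot finmap zify.

Set Implicit Arguments.
Unset Strict Implicit.
Unset Printing Implicit Defensive.

(** The attractor consists of the last target position of every directive; it
    has at most b elements.  If T[i..j] avoids it, the copy directive that
    starts a chain resolving i also covers j, for otherwise its target would end
    inside T[i..j].  Hence T[i..j] is copied as a whole from another occurrence,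
    whose first position has a shorter chain. *)

Definition target_end (n : nat) (Sigma : Type) (d : directive n Sigma) : 'I_n :=
  match d with
  | Copy _ j _ _ => j
  | Assign i _ => i
  end.

Definition target_ends (n : nat) (Sigma : choiceType)
    (M : {fset directive n Sigma}) : {set 'I_n} :=
  [set:: [seq target_end d | d <- M]].

Lemma mem_target_ends (n : nat) (Sigma : choiceType)
    (M : {fset directive n Sigma}) (d : directive n Sigma) :
  d \in M -> target_end d \in target_ends M.
Proof. by move=> dM; rewrite inE map_f. Qed.

Lemma card_target_ends (n : nat) (Sigma : choiceType)
    (M : {fset directive n Sigma}) :
  #|target_ends M| <= (#|` M|)%fset.
Proof. by rewrite cardsE (leq_trans (card_size _)) // size_map. Qed.

Lemma substr_eq (Sigma : Type) (n : nat) (T : n.-tuple Sigma)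
    (i j i' j' : 'I_n) :
    i <= j -> j - i = j' - i' -> i' <= j' ->
    (forall p q : 'I_n, i <= p <= j -> nat_of_ord q = i' + (p - i) ->
      tnth T p = tnth T q) ->
  substr T i j = substr T i' j'.
Proof.
move=> ij ji ij' Tpq.
have [jn jn'] := (ltn_ord j, ltn_ord j').
have size_substr (k l : 'I_n) : size (substr T k l) = l.+1 - k.
  by rewrite /substr size_takel // size_drop size_tuple; have := ltn_ord l; lia.
(* [nth] needs a default character; the position [i] provides one, since [Sigma] may be empty. *)
move: (tnth T i) => x0; apply: (@eq_from_nth _ x0) => [|k]; rewrite !size_substr; first lia.
move=> kij; rewrite /substr !nth_take ?nth_drop; [|lia..].
have kn : i + k < n by lia.
have kn' : i' + k < n by lia.
have := Tpq (Ordinal kn) (Ordinal kn').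
by rewrite !(tnth_nth x0) /=; apply; lia.
Qed.

Section MacroScheme.
Variables (Sigma : choiceType) (n : nat) (T : n.-tuple Sigma).
Variables (M : {fset directive n Sigma}) (hM : macro_scheme T M).

(** Prepending the copy to a chain from [q] that ends in [tnth T q] gives a chain from [p], and
    every chain from [p] ends in [tnth T p]. *)
Lemma copy_step_tnth (p q : 'I_n) : copy_step M p q -> tnth T p = tnth T q.
Proof.
move=> Mpq; apply/esym/(hM.2 p)/(resolves_copy Mpq).
exact/(hM.2 q).
Qed.

(** Induction on the chain of [i]. The right end [j] is quantified after the chain because each copy
    moves it too. *)
Lemma resolves_attracted (i : 'I_n) (c : Sigma) :
  resolves M i c -> forall j : 'I_n, i <= j ->
  exists i' j' p : 'I_n,
    [/\ i' <= j', substr T i' j' = substr T i j,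
        p \in target_ends M & i' <= p <= j'].
Proof.
elim=> {i c} [i c Mi | i q c [a [b [a' [b' [Md aib qE]]]]] _ IH] j ij.
  exists i, j, i; split=> //; last by rewrite leqnn.
  exact: (mem_target_ends Mi).
have /= wf := hM.1 _ Md.
have /= bM := mem_target_ends Md.
(* If [b <= j], the target end [b] lies in [[i, j]], so the substring is its own witness. Otherwise
   [[i, j]] lies inside [[a, b]]. *)
have [bj | jb] := leqP b j.
  by exists i, j, b; split=> //; lia.
(* The copy takes [j] to [a' + (j - a)], which stays below [b'] because both sides of the directive
   have equal length. *)
have jn : a' + (j - a) < n by have := ltn_ord b'; lia.
have qj : q <= Ordinal jn by rewrite /=; lia.
have [i1 [j1 [p [ij1 eqT pM pij]]]] := IH _ qj.
exists i1, j1, p; split=> //; rewrite {}eqT; symmetry.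
apply: substr_eq => //=; first lia.
(* The offsets add up: [q + (r - i) = a' + (i - a) + (r - i) = a' + (r - a)]. *)
move=> r s rij sE; apply: copy_step_tnth.
by exists a, b, a', b'; split=> //; lia.
Qed.

End MacroScheme.

Theorem theorem3p6 (Sigma : choiceType) (n b : nat) (T : n.-tuple Sigma)
    (M : {fset directive n Sigma}) (hM : macro_scheme T M)
    (hb : (#|` M|)%fset = b) :
  exists G : {set 'I_n}, string_attractor T G /\ #|G| <= 2 * b.
Proof.
exists (target_ends M); split; last first.
  by rewrite -hb (leq_trans (card_target_ends M)) // leq_pmull.
move=> i j; apply: (resolves_attracted hM (c := tnth T i)).
exact/(hM.2 i).
Qed.
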